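(* Let $G$ be a finite connected graph with at least two vertices. Then $$\mathrm{gp}_{\square}(G)\ \ge\ \log_{|V(G)|}\bigl(p(G)^{-1/2}\bigr)\ \ge\ 1-\log_{|V(G)|}\bigl(|V(G)|^2-|V(G)|+1\bigr).$$
   Context: For a connected graph $G$ with shortest-path distance $d_G$, a set $S\subseteq V(G)$ is a general position set if $d_G(u,v)\ne d_G(u,w)+d_G(w,v)$ holds for every choice of three distinct vertices $u,v,w\in S$ (in every role assignment), i.e. no three distinct vertices of $S$ lie on a common geodesic. The general position number $\mathrm{gp}(G)$ is the maximum cardinality of a general position set of $G$. The Cartesian product $G\,\square\,H$ has vertex set $V(G)\times V(H)$, with $(g,h)$ and $(g',h')$ adjacent if either $gg'\in E(G)$ and $h=h'$, or $g=g'$ and $hh'\in E(H)$; $G^{\square, n}$ denotes the $n$-fold Cartesian product of $G$ with itself. Define $$\mathrm{gp}_{\square}(G):=\limsup_{n\to\infty}\frac{\log_{|V(G)|}\mathrm{gp}(G^{\square,n})}{n}.$$ Let $p(G)$ denote the probability that, for a triple $(x,y,z)\in V(G)^3$ picked uniformly at random (entries need not be distinct), $d_G(y,z)=d_G(y,x)+d_G(x,z)$ holds. *)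

(* Defs.v *)
From HB Require Import structures.
From mathcomp Require Import all_boot all_order all_algebra.
From mathcomp Require Import all_classical all_reals all_analysis.

Set Implicit Arguments.
Unset Strict Implicit.
Unset Printing Implicit Defensive.

Import Order.TTheory GRing.Theory Num.Theory.

Local Open Scope nat_scope.

(** Finite simple graphs *)

Record sgraph := SGraph {
  vertex : finType;
  edge : rel vertex;
  edge_sym : symmetric edge;
  edge_irr : irreflexive edge }.

Definition connected_graph (G : sgraph) : Prop :=
  forall x y : vertex G, connect (@edge G) x y.

(* Some walk of length k joins x to y. *)
Definition walk_of_length (G : sgraph) (x y : vertex G) (k : nat) : bool :=
  [exists p : k.-tuple (vertex G), path (@edge G) x p && (last x p == y)].

(* The shortest walk between two vertices of the same component has length less
   than the number of vertices; for vertices in different components, where the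
   distance should be infinite, the value is the number of vertices. *)
Definition dist (G : sgraph) (x y : vertex G) : nat :=
  \big[Order.min/#|vertex G|]_(k < #|vertex G| | walk_of_length x y k) (k : nat).

Definition gen_pos (G : sgraph) (S : {set vertex G}) : bool :=
  [forall u in S, forall v in S, forall w in S,
    [&& u != v, u != w & v != w] ==> (dist u v != dist u w + dist w v)].

Definition gp (G : sgraph) : nat :=
  \max_(S : {set vertex G} | gen_pos S) #|S|.

(** Cartesian product *)

Section CartesianProduct.
Variables G H : sgraph.

Definition cart_edge : rel (vertex G * vertex H) := fun a b =>
  (edge a.1 b.1 && (a.2 == b.2)) || ((a.1 == b.1) && edge a.2 b.2).

Lemma cart_edge_sym : symmetric cart_edge.
Proof.
by move=> a b; rewrite /cart_edge !(edge_sym b.1, edge_sym b.2) !(eq_sym b.1, eq_sym b.2).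
Qed.

Lemma cart_edge_irr : irreflexive cart_edge.
Proof. by move=> a; rewrite /cart_edge !edge_irr andbF. Qed.

Definition cart_prod : sgraph := SGraph cart_edge_sym cart_edge_irr.

End CartesianProduct.

Lemma K1_edge_sym : symmetric (fun _ _ : unit => false).
Proof. by []. Qed.

Lemma K1_edge_irr : irreflexive (fun _ _ : unit => false).
Proof. by []. Qed.

Definition K1 : sgraph := SGraph K1_edge_sym K1_edge_irr.

(* G, G [] G, G [] (G [] G), ... for n = 1, 2, 3, ..., and K1 for n = 0. *)
Definition cart_pow (G : sgraph) (n : nat) : sgraph := iterop n cart_prod G K1.

Local Open Scope ring_scope.

Section Asymptotics.
Variable R : realType.

Definition log (b x : R) : R := ln x / ln b.

(* The term of index 0 is a division by zero, with value 0; it does not affect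
   the limit superior. *)
Definition gp_box (G : sgraph) : \bar R :=
  limn_esup (fun n : nat =>
    (log #|vertex G|%:R (gp (cart_pow G n))%:R / n%:R)%:E).

(* The triple (x, y, z) is encoded as ((x, y), z). *)
Definition between_triples (G : sgraph) :
    {set vertex G * vertex G * vertex G} :=
  [set t | let: (x, y, z) := t in dist y z == (dist y x + dist x z)%N].

Definition p_between (G : sgraph) : R :=
  #|between_triples G|%:R / (#|vertex G| ^ 3)%:R.

End Asymptotics.

(* Main.v *)
Require Import Defs.
From mathcomp Require Import all_boot all_order all_algebra zify lra ring.
From mathcomp Require Import all_classical all_reals all_analysis.

Set Implicit Arguments.
Unset Strict Implicit.
Unset Printing Implicit Defensive.

Import Order.TTheory GRing.Theory Num.Theory.
Import numFieldNormedType.Exports.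

(** Call a triple (x, y, z) between when x lies on a geodesic from y to z, let N
    be the number of vertices and t the number of between triples, so that
    p(G) = t / N ^ 3.

    The lower bound on the general position number is a deletion argument. Place
    m points at random vertices, independently. Three given distinct indices
    receive a between triple with probability p(G), so some placement has at
    most m ^ 3 * p(G) bad index triples, and this is at most m / 2 once
    2 * m ^ 2 * p(G) <= 1. Discarding one index of each bad triple leaves at
    least m / 2 indices without any bad triple ([deletion]). Collisions need no
    separate treatment: (x, x, z) is a between triple, so as soon as three
    indices are left their points are distinct, and they are in general
    position ([leq_gp_indexed]). For m = 2 * gp(G) + 1 this would be a set larger
    than gp(G), so that 1 < 2 * m ^ 2 * p(G) <= 18 * gp(G) ^ 2 * p(G)
    ([gp_lower_bound]).

    In a Cartesian product the distances of the factors add up, and since both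
    factors satisfy the triangle inequality, a triple is between exactly when
    both of its projections are ([between_cart_prod]). Therefore
    p(G ^ n) = p(G) ^ n, and gp(G ^ n) is at least a constant times
    p(G) ^ (- n / 2). Taking logarithms and dividing by n, the constant
    contributes O(1 / n), which vanishes in the limit superior.

    The second inequality of the theorem separates at 0: p(G) is a probability,
    hence log p(G) <= 0, while N ^ 2 - N + 1 >= N because (N - 1) ^ 2 >= 0. *)

(** * Distances and geodesics *)

Local Open Scope nat_scope.

Section Distance.
Variable G : sgraph.
Implicit Types (x y z : vertex G) (p : seq (vertex G)).

Lemma uniq_path_size x p : uniq (x :: p) -> size p < #|vertex G|.
Proof. by move=> /card_uniqP /= <-; exact: max_card. Qed.

(** Loops are removed first, because [dist] only ranges over walks shorter than
    the number of vertices. *)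
Lemma dist_le_path x p : path (@edge G) x p -> dist x (last x p) <= size p.
Proof.
case/shortenP => p' p'x up' subp'; have ltp' := uniq_path_size up'.
have /andP[_ /uniq_leq_size/(_ subp') le_p'] := up'.
apply: leq_trans le_p'.
rewrite /dist -leEnat; apply: (bigmin_le_cond _ (j := Ordinal ltp')).
by apply/existsP; exists (in_tuple p'); rewrite p'x /=.
Qed.

(** The default value #|V| of the minimum that defines [dist] exceeds the length
    of every duplicate-free path, so for connected vertices the minimum is
    attained by a walk. *)
Lemma dist_path x y : connect (@edge G) x y ->
  exists p, [/\ path (@edge G) x p, last x p = y & size p = dist x y].
Proof.
case/connectP => q qx ->; case/shortenP: qx => p px up _ {q}.
have /orP[/eqP dN|] : (dist x (last x p) == #|vertex G|) ||
    walk_of_length x (last x p) (dist x (last x p)).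
  set d := dist x (last x p); rewrite {}/d /dist.
  elim/big_ind: _ => [|a b|k wk]; rewrite ?eqxx ?wk ?orbT // => ha hb.
  by rewrite minEle; case: ifP.
- by have := dist_le_path px; rewrite dN leqNgt (uniq_path_size up).
- case/existsP => q /andP[qx /eqP lq]; exists q; split => //.
  by rewrite size_tuple.
Qed.

Lemma dist_self x : dist x x = 0.
Proof. by apply/eqP; rewrite -leqn0 (@dist_le_path x [::]). Qed.

Lemma dist_edge x y : edge x y -> dist x y <= 1.
Proof. by move=> xy; apply: (@dist_le_path x [:: y]); rewrite /= xy. Qed.

Lemma dist_triangle x y z : connected_graph G ->
  dist x z <= dist x y + dist y z.
Proof.
move=> G_conn.
have [p [px py <-]] := dist_path (G_conn x y).
have [q [qy qz <-]] := dist_path (G_conn y z).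
rewrite -size_cat -qz -{1}py -last_cat; apply: dist_le_path.
by rewrite cat_path px py.
Qed.

Lemma between_triplesE x y z :
  ((x, y, z) \in between_triples G) = (dist y z == dist y x + dist x z).
Proof. by rewrite inE. Qed.

Lemma between_triples_gt0 : 0 < #|vertex G| -> 0 < #|between_triples G|.
Proof.
case/card_gt0P => x _; apply/card_gt0P; exists (x, x, x).
by rewrite between_triplesE dist_self.
Qed.

End Distance.

(** * Cartesian products and powers *)

Section ProductDistance.
Variables G H : sgraph.
Hypotheses (G_conn : connected_graph G) (H_conn : connected_graph H).
Implicit Types a b c : vertex (cart_prod G H).

(** First move along a geodesic of G, then along a geodesic of H. *)
Lemma cart_prod_path a b :
  exists p : seq (vertex (cart_prod G H)),
    [/\ path (@edge (cart_prod G H)) a p, last a p = b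
      & size p = dist a.1 b.1 + dist a.2 b.2].
Proof.
case: a b => [g h] [g' h'] /=.
have [p [pg pg' <-]] := dist_path (G_conn g g').
have [q [qh qh' <-]] := dist_path (H_conn h h').
exists (map (pair^~ h) p ++ map (pair g') q).
rewrite size_cat !size_map last_cat cat_path.
rewrite -[(g, h)]/((pair^~ h) g) last_map pg' -[(g', h)]/(pair g' h) last_map qh'.
split=> //; apply/andP; split; rewrite path_map.
- by apply: sub_path pg => x y xy; rewrite /= /cart_edge /= xy eqxx.
- by apply: sub_path qh => x y xy; rewrite /= /cart_edge /= xy eqxx orbT.
Qed.

Lemma cart_prod_connected : connected_graph (cart_prod G H).
Proof.
move=> a b; have [p [pa <- _]] := cart_prod_path a b.
by apply/connectP; exists p.
Qed.

(** Every edge of the product moves one coordinate only, along an edge of that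
    factor, so a step of a walk changes the sum of the two coordinate distances
    by at most one. *)
Lemma dist_cart_prod a b : dist a b = dist a.1 b.1 + dist a.2 b.2.
Proof.
apply/eqP; rewrite eqn_leq; apply/andP; split.
  have [p [pa <- <-]] := cart_prod_path a b; exact: dist_le_path.
have [p [pa <- <-]] := dist_path (cart_prod_connected a b).
elim: p a pa => [|c p IHp] a /=; first by rewrite !dist_self.
case/andP => ac /IHp; set l := last c p => le_p.
have t1 := dist_triangle a.1 c.1 l.1 G_conn.
have t2 := dist_triangle a.2 c.2 l.2 H_conn.
apply: (leq_trans (leq_add t1 t2)).
rewrite addnACA -add1n; apply: leq_add le_p.
case/orP: ac => /andP[].
- by move=> /dist_edge ? /eqP ->; rewrite dist_self addn0.
- by move=> /eqP -> /dist_edge ?; rewrite dist_self.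
Qed.

(** A sum of two triangle inequalities is an equality if and only if both are. *)
Lemma between_cart_prod a b c :
  ((a, b, c) \in between_triples (cart_prod G H))
    = ((a.1, b.1, c.1) \in between_triples G)
      && ((a.2, b.2, c.2) \in between_triples H).
Proof.
rewrite !between_triplesE !dist_cart_prod addnACA eq_sym.
have := dist_triangle b.1 a.1 c.1 G_conn.
have := dist_triangle b.2 a.2 c.2 H_conn.
move: (dist b.1 c.1) (dist b.2 c.2) (dist b.1 a.1 + _) (dist b.2 a.2 + _).
by move=> *; lia.
Qed.

Lemma card_between_cart_prod :
  #|between_triples (cart_prod G H)|
    = #|between_triples G| * #|between_triples H|.
Proof.
rewrite -cardsX.
pose W := vertex (cart_prod G H).
pose unzip (t : W * W * W) := let: (a, b, c) := t in
  ((a.1, b.1, c.1), (a.2, b.2, c.2)).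
pose zip u : W * W * W := let: ((x, y, z), (x', y', z')) := u in
  ((x, x'), (y, y'), (z, z')).
have unzipK : cancel unzip zip by case=> [[[? ?] [? ?]] [? ?]].
have zipK : cancel zip unzip by case=> [[[? ?] ?] [[? ?] ?]].
rewrite -(card_imset _ (can_inj unzipK)); apply: eq_card => u.
rewrite -{1}[u]zipK mem_imset; last exact: can_inj unzipK.
case: u => [[[x y] z] [[x' y'] z']]; rewrite finset.in_setX.
exact: between_cart_prod.
Qed.

End ProductDistance.

Section Powers.
Variable G : sgraph.
Hypothesis G_conn : connected_graph G.

Lemma cart_powS n : cart_pow G n.+2 = cart_prod G (cart_pow G n.+1).
Proof. by []. Qed.

Lemma cart_pow_connected n : connected_graph (cart_pow G n.+1).
Proof. by elim: n => // n IHn; exact: cart_prod_connected. Qed.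

Lemma card_cart_pow n : #|vertex (cart_pow G n.+1)| = #|vertex G| ^ n.+1.
Proof.
elim: n => [|n IHn]; first by rewrite expn1.
by rewrite cart_powS [LHS]card_prod IHn -expnS.
Qed.

Lemma card_between_cart_pow n :
  #|between_triples (cart_pow G n.+1)| = #|between_triples G| ^ n.+1.
Proof.
elim: n => [|n IHn]; first by rewrite expn1.
by rewrite cart_powS card_between_cart_prod ?IHn -?expnS //; exact: cart_pow_connected.
Qed.

End Powers.

(** * The deletion argument for forbidden triples *)

Section Deletion.
Variables (V : finType) (B : {set V * V * V}) (m : nat).

Definition hits (f : {ffun 'I_m -> V}) : {set 'I_m * 'I_m * 'I_m} :=
  [set t | [&& t.1.1 != t.1.2, t.1.1 != t.2, t.1.2 != t.2 &
            (f t.1.1, f t.1.2, f t.2) \in B]].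

(** This is the estimate P(t \in hits f) <= #|B| / #|V| ^ 3 for a uniformly
    random f, with the denominators cleared. *)
Lemma card_hitting (t : 'I_m * 'I_m * 'I_m) :
  #|[set f | t \in hits f]| * #|V| ^ 3 <= #|B| * #|V| ^ m.
Proof.
case: t => [[i j] k].
have [/and3P[ij ik jk]|nd] := boolP [&& i != j, i != k & j != k]; last first.
  rewrite [X in X * _]eq_card0 // => f; rewrite !inE /=.
  by apply: contraNF nd => /and4P[-> -> ->].
have -> : #|V| ^ 3 = #|{: V * V * V}| by rewrite !card_prod !expnS muln1 mulnA.
have -> : #|V| ^ m = #|{ffun 'I_m -> V}| by rewrite card_ffun card_ord.
rewrite -[#|{: V * V * V}|]cardsT -[#|{ffun _}|]cardsT -!cardsX.
(* Exchanging the values of f at i, j, k with a given triple is injective: the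
   given triple can be read off the new function, and the values that were
   overwritten are kept as the new triple, which lies in B. *)
pose swap (u : {ffun 'I_m -> V} * (V * V * V)) : (V * V * V) * {ffun 'I_m -> V} :=
  let f := u.1 in
  ((f i, f j, f k),
   [ffun l => if l == i then u.2.1.1 else if l == j then u.2.1.2
              else if l == k then u.2.2 else f l]).
have swap_inj : injective swap.
  move=> [f [[a b] c]] [f' [[a' b'] c']] /= [] fi fj fk /ffunP e.
  have := e i; rewrite !ffunE eqxx /= => <-.
  have := e j; rewrite !ffunE (eq_sym j) (negPf ij) eqxx /= => <-.
  have := e k; rewrite !ffunE !(eq_sym k) (negPf ik) (negPf jk) eqxx /= => <-.
  congr (_, _); apply/ffunP => l; have := e l; rewrite !ffunE /=.
  case: (eqVneq l i) => [-> //|_]; case: (eqVneq l j) => [-> //|_].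
  by case: (eqVneq l k) => [->|].
rewrite -(card_imset _ swap_inj); apply/subset_leq_card/fintype.subsetP.
move=> _ /imsetP[u + ->].
by rewrite !finset.in_setX !finset.in_setT !andbT !inE andbT => /and4P[].
Qed.

(** The average number of bad index triples is at most m / 2, by linearity of
    expectation, here a double count of the pairs (f, t) with t \in hits f. *)
Lemma few_hits : 2 * m ^ 2 * #|B| <= #|V| ^ 3 -> 0 < #|V| ->
  exists f : {ffun 'I_m -> V}, 2 * #|hits f| <= m.
Proof.
move=> mB V_gt0.
suff : ~~ [forall f : {ffun 'I_m -> V}, m.+1 <= 2 * #|hits f|].
  by case/forallPn => f; rewrite -leqNgt => ?; exists f.
apply/negP => /forallP all_hit.
have V3 : 0 < #|V| ^ 3 by rewrite expn_gt0 V_gt0.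
have Vm : 0 < #|V| ^ m by rewrite expn_gt0 V_gt0.
have sum_cst (T : finType) c : \sum_(x : T) c = #|T| * c.
  by rewrite -sum_nat_const; apply: eq_bigl.
have lb : m.+1 * #|V| ^ m <= 2 * \sum_(f : {ffun 'I_m -> V}) #|hits f|.
  have <- : #|{ffun 'I_m -> V}| = #|V| ^ m by rewrite card_ffun card_ord.
  by rewrite big_distrr mulnC -sum_cst; apply: leq_sum => f _; exact: all_hit.
have ub : (\sum_(f : {ffun 'I_m -> V}) #|hits f|) * #|V| ^ 3 <= m ^ 3 * (#|B| * #|V| ^ m).
  have -> : \sum_(f : {ffun 'I_m -> V}) #|hits f|
      = \sum_(t : 'I_m * 'I_m * 'I_m) #|[set f | t \in hits f]|.
    transitivity (\sum_(f : {ffun 'I_m -> V}) \sum_t (t \in hits f : nat)).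
      by apply: eq_bigr => f _; rewrite -sum1_card big_mkcond;
        apply: eq_bigr => t _; case: ifP.
    rewrite exchange_big; apply: eq_bigr => t _.
    by rewrite -sum1_card [RHS]big_mkcond; apply: eq_bigr => f _; rewrite inE; case: ifP.
  have <- : #|{: 'I_m * 'I_m * 'I_m}| = m ^ 3.
    by rewrite !card_prod card_ord !expnS muln1 mulnA.
  rewrite big_distrl -sum_cst; apply: leq_sum => t _; exact: card_hitting.
have : m.+1 * (#|V| ^ m * #|V| ^ 3) <= m * (#|V| ^ m * #|V| ^ 3).
  rewrite mulnA; apply: (leq_trans (leq_mul lb (leqnn _))).
  rewrite -mulnA; apply: (leq_trans (leq_mul (leqnn 2) ub)).
  have -> : 2 * (m ^ 3 * (#|B| * #|V| ^ m)) = m * (#|V| ^ m * (2 * m ^ 2 * #|B|)) by lia.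
  by apply: leq_mul => //; apply: leq_mul.
by rewrite leq_pmul2r ?ltnn // muln_gt0 Vm.
Qed.

(** Each bad triple is destroyed by discarding its first index. *)
Lemma deletion : 2 * m ^ 2 * #|B| <= #|V| ^ 3 -> 0 < #|V| ->
  exists (f : {ffun 'I_m -> V}) (I : {set 'I_m}), m <= 2 * #|I| /\
    {in I & &, forall i j k, i != j -> i != k -> j != k -> (f i, f j, f k) \notin B}.
Proof.
move=> mB V_gt0; have [f few] := few_hits mB V_gt0.
pose D := [set t.1.1 | t in hits f]; exists f, (~: D); split.
  have leD : #|D| <= #|hits f| by exact: leq_imset_card.
  have := cardsC D; rewrite card_ord.
  by move: few leD; move: #|hits f| #|D| #|~: D| => ? ? ?; lia.
move=> i j k; rewrite inE => Di _ _ ij ik jk; apply: contra Di => fB.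
by apply/imsetP; exists (i, j, k); rewrite // inE /= ij ik jk.
Qed.

End Deletion.

(** * A lower bound on the general position number *)

Section GeneralPosition.
Variable G : sgraph.

Lemma leq_gp (S : {set vertex G}) : gen_pos S -> #|S| <= gp G.
Proof. exact: (@leq_bigmax_cond _ _ (fun S : {set vertex G} => #|S|)). Qed.

Lemma gen_pos_small (S : {set vertex G}) : #|S| <= 2 -> gen_pos S.
Proof.
move=> S2; apply/forall_inP => u uS; apply/forall_inP => v vS.
apply/forall_inP => w wS; apply/implyP => /and3P[uv uw vw].
have : #|u |: (v |: [set w])| <= #|S|.
  by apply/subset_leq_card; rewrite !finset.subUset !finset.sub1set uS vS wS.
by rewrite !cardsU1 !inE cards1 (negPf uv) (negPf uw) (negPf vw)
  leqNgt (leq_ltn_trans S2).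
Qed.

Lemma gp_ge2 : 2 <= #|vertex G| -> 2 <= gp G.
Proof.
rewrite -cardsT => /card_gt1P[x [y [_ _ xy]]].
have c2 : #|[set x; y]| = 2 by rewrite cards2 xy.
by rewrite -{1}c2; apply/leq_gp/gen_pos_small; rewrite c2.
Qed.

(** A third index k is what rules out a collision f i = f j: the triple
    (f i, f j, f k) would be between, as dist (f j) (f i) = 0. *)
Lemma leq_gp_indexed m (f : {ffun 'I_m -> vertex G}) (I : {set 'I_m}) :
  {in I & &, forall i j k, i != j -> i != k -> j != k ->
    (f i, f j, f k) \notin between_triples G} ->
  3 <= #|I| -> #|I| <= gp G.
Proof.
move=> free I3.
have f_inj : {in I &, injective f}.
  move=> i j iI jI fij; apply/eqP/negPn/negP => ij.
  have /card_gt0P[k] : 0 < #|I :\ i :\ j|.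
    by have := cardsD1 i I; have := cardsD1 j (I :\ i); rewrite iI; lia.
  rewrite !inE => /and3P[kj ki kI].
  have := free i j k iI jI kI ij; rewrite (eq_sym i) (eq_sym j) => /(_ ki kj).
  by rewrite between_triplesE fij dist_self eqxx.
rewrite -(card_in_imset f_inj); apply: leq_gp.
apply/forall_inP => _ /imsetP[j jI ->]; apply/forall_inP => _ /imsetP[k kI ->].
apply/forall_inP => _ /imsetP[i iI ->]; apply/implyP => /and3P[jk ji ki].
have ne a b : f a != f b -> a != b by apply: contra_neq => ->.
rewrite -between_triplesE; apply: free => //; last exact: ne.
  by apply: ne; rewrite eq_sym.
by apply: ne; rewrite eq_sym.
Qed.

(** The constant 18 is 2 * 3 ^ 2, from 2 * m ^ 2 with m = 2 * gp + 1 <= 3 * gp. *)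
Lemma gp_lower_bound : 2 <= #|vertex G| ->
  #|vertex G| ^ 3 <= 18 * gp G ^ 2 * #|between_triples G|.
Proof.
move=> N2; have g2 := gp_ge2 N2.
(* Otherwise the deletion argument keeps at least m / 2 indices, hence at least
   gp + 1 of them, and at least three because gp >= 2. *)
have big_m : #|vertex G| ^ 3 < 2 * (gp G).*2.+1 ^ 2 * #|between_triples G|.
  rewrite ltnNge; apply/negP => le_m.
  have [f [I [mI free]]] := deletion le_m (ltnW N2).
  have I3 : 3 <= #|I| by lia.
  by have := leq_gp_indexed free I3; lia.
apply: (leq_trans (ltnW big_m)); rewrite leq_mul2r; apply/orP; right.
have : (gp G).*2.+1 ^ 2 <= (3 * gp G) ^ 2 by rewrite leq_exp2r //; lia.
rewrite expnMn; lia.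
Qed.

End GeneralPosition.

(** * Lower bounds on limits superior *)

Local Open Scope ring_scope.

Section LimSup.
Local Open Scope classical_set_scope.

Lemma cvg_le_limn_esup (R : realType) (u v : R^nat) (l : R) :
  v @ \oo --> l -> (\forall n \near \oo, v n <= u n) ->
  (l%:E <= limn_esup (fun n => (u n)%:E))%E.
Proof.
move=> vl vu; apply: le_ereal_inf_tmp => _ [A nA <-].
have vlE : (v n)%:E @[n --> \oo] --> l%:E.
  by apply: cvg_EFin => //; exact: nearW.
rewrite -(cvg_lim _ vlE) //; apply: lime_le; first by apply/cvg_ex; exists l%:E.
near=> n; apply: (@le_trans _ _ (u n)%:E); first by rewrite lee_fin; near: n.
by apply: ereal_sup_ubound; exists n => //; near: n.
Unshelve. all: by end_near. Qed.

End LimSup.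

(** * Asymptotics of the powers *)

Section Logarithms.
Variables (R : realType) (G : sgraph).
Hypotheses (G_conn : connected_graph G) (G_card : (2 <= #|vertex G|)%N).
Local Notation N := #|vertex G|.
Local Notation t := #|between_triples G|.

Let N_gt0 : 0 < N%:R :> R.
Proof. by rewrite ltr0n ltnW. Qed.

Let t_gt0 : 0 < t%:R :> R.
Proof. by rewrite ltr0n between_triples_gt0 // ltnW. Qed.

Let lnN_gt0 : 0 < ln (N%:R : R).
Proof. by rewrite ln_gt0 // ltr1n. Qed.

Lemma ln_p_between : ln (p_between R G) = ln t%:R - 3 * ln N%:R.
Proof.
rewrite /p_between natrX ln_div ?posrE ?exprn_gt0 // lnXn //.
by rewrite mulr_natl.
Qed.

Lemma p_between_le1 : p_between R G <= 1.
Proof.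
rewrite /p_between ler_pdivrMr ?ltr0n ?expn_gt0 ?(ltnW G_card) // mul1r ler_nat.
by rewrite !expnS expn0 muln1 mulnA -!card_prod max_card.
Qed.

Lemma log_p_between : log N%:R (p_between R G `^ (- (1 / 2))) =
  - (ln (p_between R G) / 2) / ln N%:R.
Proof. by rewrite /log ln_powR; congr (_ / _); lra. Qed.

(** The logarithm of [gp_lower_bound] for the power of exponent n + 1, whose
    numbers of vertices and of between triples are powers of those of G. *)
Lemma log_gp_cart_pow n :
  log N%:R (p_between R G `^ (- (1 / 2)))
    - ln 18 / (2 * ln N%:R) * harmonic n
  <= log N%:R (gp (cart_pow G n.+1))%:R / n.+1%:R.
Proof.
have := card_cart_pow G n; set W := vertex _ => WN.
have W2 : (2 <= #|W|)%N by
  rewrite WN (leq_trans G_card) // -{1}[N]expn1 leq_pexp2l // ltnW.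
have gp0 : 0 < (gp (cart_pow G n.+1))%:R :> R by rewrite ltr0n ltnW // gp_ge2.
have := gp_lower_bound W2; rewrite card_between_cart_pow // -/W WN.
rewrite -(ler_nat R) !(natrX, natrM) -ler_ln ?posrE; last 2 first.
- by rewrite !exprn_gt0.
- by rewrite !mulr_gt0 ?exprn_gt0.
rewrite 2?lnXn ?exprn_gt0 // lnM ?posrE ?mulr_gt0 ?exprn_gt0 // lnM ?posrE ?exprn_gt0 //.
rewrite !lnXn // -[_ *+ 3]mulr_natr -[_ *+ 2]mulr_natr.
rewrite -[ln N%:R *+ _]mulr_natr -[ln t%:R *+ _]mulr_natr.
rewrite log_p_between ln_p_between /log /= /harmonic.
(* What is left is linear in ln t and ln gp, with positive denominators. *)
move: (ln _%:R) lnN_gt0 (ln t%:R) (ln (gp _)%:R) => L L0 T g.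
have n0 : 0 < n.+1%:R :> R by [].
move: n.+1%:R n0 => k k0 le.
rewrite -subr_ge0.
have -> : g / L / k - (- ((T - 3 * L) / 2) / L - ln 18 / (2 * L) * k^-1) =
  (ln 18 + g * 2 + T * k - L * k * 3) / (2 * L * k).
  by field; rewrite !gt_eqF.
by rewrite divr_ge0 ?subr_ge0 // !mulr_ge0 // ltW.
Qed.

Lemma gp_box_lower_bound :
  ((log N%:R (p_between R G `^ (- (1 / 2))))%:E <= gp_box R G)%E.
Proof.
set c := log _ _.
pose v n := c - ln 18 / (2 * ln N%:R) * harmonic n.-1.
apply: (@cvg_le_limn_esup _ _ v).
  rewrite -[X in cvg_to _ (nbhs X)](subr0 c).
  rewrite -[X in c - X](mulr0 (ln 18 / (2 * ln N%:R))).
  apply: cvgB; first exact: cvg_cst.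
  apply: cvgM; first exact: cvg_cst.
  rewrite -cvg_shiftS; exact: cvg_harmonic.
by exists 1%N => // -[//|n] _; exact: log_gp_cart_pow.
Qed.

Lemma log_p_between_lower_bound :
  1 - log (N%:R : R) (N%:R ^+ 2 - N%:R + 1)
    <= log (N%:R : R) (p_between R G `^ (- (1 / 2))).
Proof.
apply: (@le_trans _ _ 0).
  rewrite subr_le0 /log ler_pdivlMr // mul1r ler_ln ?posrE //.
    by have := sqr_ge0 (N%:R - 1 : R); nra.
  by have := sqr_ge0 (N%:R - 1 : R); nra.
rewrite log_p_between; apply: divr_ge0; last exact: ltW.
have := ln_le0 p_between_le1; lra.
Qed.
End Logarithms.

Theorem theorem5p1 (R : realType) (G : sgraph)
    (G_conn : connected_graph G) (G_card : (2 <= #|vertex G|)%N) :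
  ((log (#|vertex G|%:R : R) (p_between R G `^ (- (1 / 2))))%:E
     <= gp_box R G)%E /\
  1 - log (#|vertex G|%:R : R) (#|vertex G|%:R ^+ 2 - #|vertex G|%:R + 1)
    <= log (#|vertex G|%:R : R) (p_between R G `^ (- (1 / 2))).
Proof.
by split; [exact: gp_box_lower_bound | exact: log_p_between_lower_bound].
Qed.
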